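(* Let $G$ be a group acting linearly on a nonzero finite-dimensional complex vector space $V$, let $d\ge3$, and let $f\in\operatorname{Sym}^d(V^* )$ be nondegenerate with $G$-invariant Jacobian $J(f)$. Put $N=\operatorname{rad}Z(f)$, the Jacobson radical of the center of $f$. Then $NV$ is a proper $G$-submodule of $V$. If, in addition, $V$ is irreducible, then $\operatorname{rad}Z(f)=0$, and in this case $G$ acts transitively on the primitive idempotents of $Z(f)$ (by conjugation) and on the canonical blocks $V_1,\dots,V_r$ of $f$.
   Context: $G$ acts on forms by $(g\cdot h)(x)=h(g^{-1}x)$. For $v\in V$, $D_v$ is directional differentiation; $J(f)=\langle D_vf:v\in V\rangle\subseteq\operatorname{Sym}^{d-1}(V^* )$ is the Jacobian of $f$, $G$-invariant if $g\cdot J(f)=J(f)$ for all $g\in G$. The form $f$ is nondegenerate if $D_vf=0$ implies $v=0$. Let $\Theta_f:V^d\to\mathbb C$ be the polarization of $f$, the unique symmetric $d$-linear form with $\Theta_f(v,\dots,v)=f(v)$. The center of $f$ is $$Z(f)=\{X\in\operatorname{End}(V):\Theta_f(Xv_1,v_2,v_3,\dots,v_d)=\Theta_f(v_1,Xv_2,v_3,\dots,v_d)\ \text{for all }v_i\in V\},$$ a finite-dimensional commutative $\mathbb C$-algebra when $f$ is nondegenerate and $d\ge3$ (Harrison). If $e_1,\dots,e_r$ are the primitive idempotents of $Z(f)$, the canonical blocks of $f$ are $V_i=e_iV$, so $V=V_1\oplus\cdots\oplus V_r$. When $f$ is nondegenerate and $J(f)$ is $G$-invariant, $gZ(f)g^{-1}=Z(f)$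 for all $g\in G$, so $G$ acts on $Z(f)$ by conjugation $z\mapsto gzg^{-1}$, permuting the primitive idempotents and the blocks. $NV$ denotes the span of all $nv$ with $n\in N$, $v\in V$. *)

(* Defs.v *)
From HB Require Import structures.
From mathcomp Require Import all_boot all_order all_fingroup all_algebra.
From mathcomp Require Import boolp classical_sets reals complex.
From mathcomp Require Import mpoly.

Set Implicit Arguments.
Unset Strict Implicit.
Unset Printing Implicit Defensive.

Import Order.TTheory GRing.Theory Num.Theory.
Local Open Scope classical_set_scope.
Local Open Scope ring_scope.

(* The symmetric algebra of the dual of V is identified with                  *)
(* {mpoly F[\dim {:V}]}, the variable 'X_i standing for the i-th coordinate   *)
(* form of vbasis {:V}; its degree d part consists of the d.-homog elements.  *)

Section Forms.
Variables (F : fieldType) (V : vectType F).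
Implicit Types (f h : {mpoly F[\dim {:V}]}) (v : V) (X : 'End(V)) (d : nat).

Definition coords v (i : 'I_(\dim {:V})) : F := coord (vbasis {:V}) i v.

Definition form_eval h v : F := h.@[coords v].

(* The form x |-> h (X x), see form_eval_comp. *)
Definition form_comp h X : {mpoly F[\dim {:V}]} :=
  h \mPo [tuple \sum_(j < \dim {:V}) coords (X (vbasis {:V})`_j) i *: 'X_j
          | i < \dim {:V}].

Definition dirder v f : {mpoly F[\dim {:V}]} := \sum_i coords v i *: f^`M(i).

Definition nondegenerate_form f := forall v, dirder v f = 0 -> v = 0.

Definition span_of (W : lmodType F) (S : set W) : set W :=
  [set w | exists m (c : 'I_m -> F) (s : 'I_m -> W),
     (forall i, S (s i)) /\ w = \sum_i c i *: s i].

Definition jacobian f : set {mpoly F[\dim {:V}]} :=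
  span_of [set h | exists v, h = dirder v f].

Definition set_arg d (w : {ffun 'I_d -> V}) (i : 'I_d) (x : V) :=
  [ffun k => if k == i then x else w k].

Definition is_polarization d f (Theta : {ffun 'I_d -> V} -> F) : Prop :=
  [/\ forall (w : {ffun 'I_d -> V}) i a x y,
        Theta (set_arg w i (a *: x + y))
        = a * Theta (set_arg w i x) + Theta (set_arg w i y),
      forall (w : {ffun 'I_d -> V}) (s : 'S_d),
        Theta [ffun k => w (s k)] = Theta w
    & forall v, Theta [ffun => v] = form_eval f v].

(* By polarizationP and polarization_uniq below, this is the polarization of  *)
(* f when f is d.-homog and F is a numFieldType.                              *)
Definition polarization d f : {ffun 'I_d -> V} -> F :=
  xget (fun=> 0) (is_polarization f).

(* The arguments of Theta_f are numbered from 0. *)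
Definition form_center d f : set 'End(V) :=
  [set X | forall w : {ffun 'I_d -> V},
     polarization f [ffun k => if val k == 0%N then X (w k) else w k]
     = polarization f [ffun k => if val k == 1%N then X (w k) else w k]].

End Forms.

(* A is meant to be a unital subalgebra of 'End(V). *)
Section EndAlgebra.
Variables (F : fieldType) (V : vectType F).
Implicit Types (A I M N : set 'End(V)) (e : 'End(V)).

Definition left_ideal A I : Prop :=
  [/\ I `<=` A, I 0,
      forall x y, I x -> I y -> I (x - y)
    & forall a x, A a -> I x -> I (a \o x)%VF].

Definition maximal_left_ideal A M : Prop :=
  [/\ left_ideal A M, M <> A
    & forall I, left_ideal A I -> M `<=` I -> I = M \/ I = A].

Definition jacobson_radical A : set 'End(V) :=
  [set x | A x /\ forall M, maximal_left_ideal A M -> M x].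

Definition idempotent_in A e : Prop := A e /\ (e \o e)%VF = e.

Definition primitive_idempotent A : set 'End(V) :=
  [set e | [/\ idempotent_in A e, e <> 0
    & forall e1 e2, idempotent_in A e1 -> idempotent_in A e2 ->
        (e1 \o e2)%VF = 0 -> (e2 \o e1)%VF = 0 -> e = e1 + e2 ->
        e1 = 0 \/ e2 = 0]].

Definition canonical_blocks A : set {vspace V} :=
  [set U | exists2 e, primitive_idempotent A e & U = limg e].

Definition set_mul N : set V :=
  span_of [set v | exists2 n, N n & exists u, v = n u].

End EndAlgebra.

Section Actions.
Variables (G : groupType) (F : fieldType) (V : vectType F).
Implicit Types (rho : G -> 'End(V)) (W : set V).

Definition linear_action rho : Prop :=
  rho 1%g = \1%VF /\ forall g h, rho (g * h)%g = (rho g \o rho h)%VF.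

Definition form_act rho (g : G) (h : {mpoly F[\dim {:V}]}) :
    {mpoly F[\dim {:V}]} :=
  form_comp h (rho g^-1%g).

Definition invariant_jacobian rho (f : {mpoly F[\dim {:V}]}) : Prop :=
  forall g, form_act rho g @` jacobian f = jacobian f.

Definition submodule rho W : Prop :=
  [/\ W 0, forall (a : F) x y, W x -> W y -> W (a *: x + y)
    & forall g x, W x -> W (rho g x)].

Definition irreducible rho : Prop :=
  (exists v : V, v <> 0) /\
  forall W, submodule rho W -> W = [set 0] \/ W = setT.

Definition conj_act rho (g : G) (z : 'End(V)) : 'End(V) :=
  (rho g \o z \o rho g^-1%g)%VF.

Definition space_act rho (g : G) (U : {vspace V}) : {vspace V} :=
  (rho g @: U)%VS.

(* S is stable under act and forms a single (hence nonempty) orbit. *)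
Definition acts_transitively (T : Type) (act : G -> T -> T) (S : set T) :=
  [/\ S !=set0, forall g x, S x -> S (act g x)
    & forall x y, S x -> S y -> exists g, y = act g x].

End Actions.

Section FormFacts.
Variables (F : fieldType) (V : vectType F).
Implicit Types (f h : {mpoly F[\dim {:V}]}) (v : V) (X : 'End(V)).

Lemma form_eval_comp h X v : form_eval (form_comp h X) v = form_eval h (X v).
Proof.
rewrite /form_eval /form_comp comp_mpoly_meval; apply: meval_eq => i.
rewrite tnth_mktuple raddf_sum /=.
rewrite {2}(coord_vbasis (memvf v)) /coords !linear_sum /=.
by apply: eq_bigr => j _; rewrite mevalZ mevalXU !linearZ /= mulrC.
Qed.

Lemma dirder_comm u v f : dirder u (dirder v f) = dirder v (dirder u f).
Proof.
have E x y : dirder x (dirder y f) =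
    \sum_i \sum_j (coords x i * coords y j) *: f^`M(j)^`M(i).
  rewrite /dirder; apply: eq_bigr => i _.
  rewrite (raddf_sum (mderiv i)) scaler_sumr; apply: eq_bigr => j _ /=.
  by rewrite mderivZ scalerA.
rewrite !E [LHS]exchange_big; apply: eq_bigr => i _; apply: eq_bigr => j _ /=.
by rewrite mulrC mderiv_comm.
Qed.

Lemma dirder_linear f a u v :
  dirder (a *: u + v) f = a *: dirder u f + dirder v f.
Proof.
rewrite /dirder scaler_sumr -big_split; apply: eq_bigr => i _ /=.
by rewrite /coords linearP scalerDl scalerA.
Qed.

Lemma dirder_is_linear v : linear (dirder v : {mpoly F[\dim {:V}]} -> _).
Proof.
move=> a p q; rewrite /dirder scaler_sumr -big_split; apply: eq_bigr => i _ /=.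
by rewrite mderivD mderivZ scalerDr !scalerA mulrC.
Qed.

HB.instance Definition _ v :=
  GRing.isLinear.Build F {mpoly F[\dim {:V}]} {mpoly F[\dim {:V}]} _
    (dirder v) (dirder_is_linear v).

Lemma euler d f v : f \is d.-homog ->
  form_eval (dirder v f) v = d%:R * form_eval f v.
Proof.
move=> /dhomogP hf.
have S : f = \sum_(m <- msupp f) f@_m *: 'X_[m] by exact: mpolyE.
move: (msupp f) (fun m => f@_m) hf S => s c hf ->.
rewrite linear_sum /form_eval !(raddf_sum (meval _)) /= mulr_sumr.
rewrite big_seq [RHS]big_seq; apply: eq_bigr => m /hf dm.
rewrite linearZ !mevalZ mulrCA; congr (_ * _).
rewrite -{}dm mevalX /= mdegE natr_sum mulr_suml (raddf_sum (meval _)).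
apply: eq_bigr => i _ /=; rewrite mevalZ mderivX mevalZ mevalX.
case E': (m i) => [|k]; first by rewrite !(mul0r, mulr0).
rewrite mulrCA; congr (_ * _).
rewrite (bigD1 i) //= [in RHS](bigD1 i) //= mulrA; congr (_ * _).
  by rewrite mnmBE mnm1E eqxx E' subn1 -exprS.
by apply: eq_bigr => j ji; rewrite mnmBE mnm1E eq_sym (negbTE ji) subn0.
Qed.

Lemma dirder_homog d f v : f \is d.+1.-homog -> dirder v f \is d.-homog.
Proof.
move=> hf; apply: rpred_sum => i _; apply: rpredZ.
apply/dhomogP => m; rewrite mcoeff_msupp mcoeff_mderiv => nz.
have /(elimT (dhomogP _ _ _) hf _) : (m + U_(i))%MM \in msupp f.
  by rewrite mcoeff_msupp; apply: contraNneq nz => ->; rewrite mul0rn.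
by rewrite /= mdegD mdeg1 addn1 => -[].
Qed.

Lemma iter_dirder d f v : f \is d.-homog ->
  (iter d (dirder v) f)@_0%MM = d`!%:R * form_eval f v.
Proof.
elim: d f => [|d IH] f hf.
  rewrite /= fact0 mul1r /form_eval.
  have -> : f = (f@_0%MM)%:MP.
    apply/mpolyP => m; rewrite mcoeffC.
    case: eqVneq => [->|nz]; first by rewrite mulr1.
    rewrite mulr0; apply: (dhomog_nemf_coeff hf).
    by rewrite mdeg_eq0.
  by rewrite mevalC mcoeffC eqxx mulr1.
rewrite iterSr IH ?dirder_homog // (euler _ hf) factS mulrA -natrM.
by rewrite mulnC.
Qed.

End FormFacts.

Section Polarization.
Variables (F : numFieldType) (V : vectType F) (d : nat).
Implicit Types (f : {mpoly F[\dim {:V}]}) (w : {ffun 'I_d -> V}).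

Local Notation dirders f s := (foldr (@dirder F V) f s).

Lemma dirders_perm (s1 s2 : seq V) f : perm_eq s1 s2 ->
  dirders f s1 = dirders f s2.
Proof.
elim: s1 s2 => [|x s1 IH] s2 /=; first by rewrite perm_sym => /perm_nilP ->.
move=> h; have : x \in s2 by rewrite -(perm_mem h) mem_head.
move=> /path.splitPr hs; case: hs h => s t h {s2}.
have {IH} -> : dirders f s1 = dirders f (s ++ t).
  by apply: IH; rewrite -(perm_cons x) (perm_trans h) // -cat1s perm_catCA.
by elim: s {h} => //= y s IHs; rewrite dirder_comm -IHs.
Qed.

Lemma polarization_exists f : f \is d.-homog ->
  exists Theta : {ffun 'I_d -> V} -> F, is_polarization f Theta.
Proof.
move=> hf.
exists (fun w => d`!%:R^-1 * (dirders f [seq w i | i <- enum 'I_d])@_0%MM); split.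
- move=> w i a x y.
  have E z : dirders f [seq set_arg w i z k | k <- enum 'I_d] =
      dirder z (dirders f [seq w k | k <- rem i (enum 'I_d)]).
    have := perm_map (set_arg w i z) (perm_to_rem (mem_enum 'I_d i)).
    move/dirders_perm=> /(_ f) -> /=; rewrite ffunE eqxx.
    congr (dirder _ (foldr _ _ _)); apply/eq_in_map => k.
    by rewrite mem_rem_uniq ?enum_uniq // inE ffunE => /andP[/negbTE ->].
  by rewrite !E dirder_linear mcoeffD mcoeffZ mulrDr mulrCA.
- move=> w s; congr (_ * _@_ _); apply: dirders_perm.
  rewrite (eq_map (g := w \o s)); last by move=> k; rewrite ffunE.
  rewrite map_comp; apply: perm_map; apply: uniq_perm; rewrite ?enum_uniq //.
    by rewrite map_inj_uniq ?enum_uniq //; apply: perm_inj.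
  move=> k; rewrite mem_enum; apply/mapP; exists (s^-1%g k).
    by rewrite mem_enum.
  by rewrite permKV.
move=> v; apply: (@mulfI _ d`!%:R).
  by rewrite pnatr_eq0 -lt0n fact_gt0.
rewrite -iter_dirder // mulVKf ?pnatr_eq0 -?lt0n ?fact_gt0 //; congr _@_ _.
rewrite (eq_map (g := fun=> v)); last by move=> k; rewrite ffunE.
by rewrite -[in RHS](size_enum_ord d); elim: (enum _) => //= _ s ->.
Qed.

Definition fill (s : seq 'I_d) w (x : V) : {ffun 'I_d -> V} :=
  [ffun k => if k \in s then x else w k].

Lemma multilinear_line (Theta : {ffun 'I_d -> V} -> F) s w x y :
  (forall w i a x y, Theta (set_arg w i (a *: x + y))
     = a * Theta (set_arg w i x) + Theta (set_arg w i y)) ->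
  uniq s ->
  exists q : {poly F}, [/\ forall t, Theta (fill s w (t *: y + x)) = q.[t],
    q`_0 = Theta (fill s w x)
    & q`_1 = \sum_(j <- s) Theta (set_arg (fill s w x) j y)].
Proof.
move=> lin; elim: s w => [|c s IH] w /=.
  move=> _; exists (Theta w)%:P.
  have E z : fill [::] w z = w by apply/ffunP => k; rewrite ffunE.
  by rewrite big_nil !coefC; split=> [t||] //=; rewrite E ?hornerC.
case/andP => cs us.
have E w' z : fill (c :: s) w' z = set_arg (fill s w' z) c z.
  by apply/ffunP => k; rewrite !ffunE inE; case: eqP.
have E' w' z z' : set_arg (fill s w' z) c z' = fill s (set_arg w' c z') z.
  apply/ffunP => k; rewrite !ffunE; case: eqP => [->|//].
  by rewrite (negbTE cs).
have [q2 [h2 h20 h21]] := IH (set_arg w c y) us.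
have [q1 [h1 h10 h11]] := IH (set_arg w c x) us.
exists (q1 + q2 * 'X); split=> [t||].
- by rewrite E lin !E' h1 h2 !hornerE addrC mulrC.
- by rewrite coefD coefMX addr0 h10 E E'.
rewrite coefD coefMX /= h11 h20 big_cons addrC E.
congr (Theta _ + _).
  by apply/ffunP => k; rewrite !ffunE; case: eqP => [->|//]; rewrite (negbTE cs).
rewrite !big_seq; apply: eq_bigr => j js; congr (Theta _).
by rewrite E'.
Qed.

Lemma polarization_uniq f (Theta1 Theta2 : {ffun 'I_d -> V} -> F) :
  is_polarization f Theta1 -> is_polarization f Theta2 -> Theta1 = Theta2.
Proof.
move=> [lin1 sym1 diag1] [lin2 sym2 diag2].
pose Theta w := Theta1 w - Theta2 w.
have lin w i a x y : Theta (set_arg w i (a *: x + y))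
     = a * Theta (set_arg w i x) + Theta (set_arg w i y).
  by rewrite /Theta lin1 lin2 mulrBr opprD addrACA.
have sym w (s : 'S_d) : Theta [ffun k => w (s k)] = Theta w.
  by rewrite /Theta sym1 sym2.
suff H n (B : {set 'I_d}) w x : #|B| = n -> Theta (fill (enum (~: B)) w x) = 0.
  apply/funext => w; apply/eqP; rewrite -subr_eq0; apply/eqP.
  rewrite -/(Theta w) -(H d (finset.setTfor 'I_d) w 0) ?cardsT ?card_ord //.
  by congr (Theta _); apply/ffunP => k; rewrite ffunE mem_enum !inE.
elim: n B w x => [|n IH] B w x.
  move/cards0_eq => B0; suff -> : fill (enum (~: B)) w x = [ffun => x].
    by rewrite /Theta diag1 diag2 subrr.
  by apply/ffunP => k; rewrite !ffunE mem_enum B0 !inE.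
move=> cB; have /card_gt0P [a aB] : (0 < #|B|)%N by rewrite cB.
pose B' := (B :\ a)%SET; set s := enum (~: B').
have aS : a \in s by rewrite mem_enum !inE eqxx.
have cB' : #|B'| = n by move: cB; rewrite (cardsD1 a B) aB => -[].
have [q [hq _ q1]] :=
  multilinear_line w x (w a) lin (enum_uniq _ : uniq s).
have q0 : q = 0.
  apply: (@roots_geq_poly_eq0 _ _ (mkseq (fun i => i%:R) (size q))).
  - by apply/allP => t _; rewrite /root -hq IH.
  - by rewrite mkseq_uniq // => i j /eqP; rewrite eqr_nat => /eqP.
  - by rewrite size_mkseq.
move: q1; rewrite q0 coef0.
have E j : j \in s ->
    Theta (set_arg (fill s w x) j (w a)) = Theta (fill (enum (~: B)) w x).
  move=> js; rewrite -[LHS](sym _ (tperm a j)); congr (Theta _).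
  apply/ffunP => k; rewrite !ffunE.
  have -> : (tperm a j k == j) = (k == a).
    by rewrite -{2}(tpermL a j) (inj_eq perm_inj).
  case: eqVneq => [->|ka]; first by rewrite mem_enum !inE aB.
  have -> : (k \in enum (~: B)) = (k \in s) by rewrite !mem_enum !inE ka.
  case: tpermP => [ek|->|_ _] //; first by rewrite ek eqxx in ka.
  by rewrite js aS.
rewrite big_seq (eq_bigr _ E) -big_seq big_const_seq count_predT iter_addr_0.
move/esym/eqP; rewrite mulrn_eq0 => /orP[|/eqP //].
by rewrite size_eq0 => /eqP s0; rewrite s0 in aS.
Qed.

Lemma polarizationP f : f \is d.-homog ->
  is_polarization f (@polarization F V d f).
Proof. by move=> /polarization_exists [Theta h]; apply: (xgetI (fun=> 0) h). Qed.

End Polarization.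

(* Main.v *)
Require Import Defs.
From HB Require Import structures.
From mathcomp Require Import all_boot all_order all_fingroup all_algebra.
From mathcomp Require Import boolp classical_sets reals complex.
From mathcomp Require Import mpoly.

Set Implicit Arguments.
Unset Strict Implicit.
Unset Printing Implicit Defensive.

Import Order.TTheory GRing.Theory Num.Theory.
Local Open Scope classical_set_scope.
Local Open Scope ring_scope.

(* Writing D_u for directional derivatives, X lies in the center iff          *)
(* D_{Xu} D_v f = D_u D_{Xv} f for all u, v. Since d >= 3, it is enough that  *)
(* for every v some v' satisfies D_{Xx} D_v f = D_x D_{v'} f for all x; this  *)
(* involves f only through J(f), so G normalizes the center A.                *)
(* If U is a maximal proper A-submodule of V, then rad A kills the simple     *)
(* module V / U, so NV lies in U; when V is irreducible, NV = 0, so N = 0.    *)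
(* Two primitive idempotents of a commutative algebra are equal or            *)
(* orthogonal: if e' were orthogonal to every g e g^-1, the proper nonzero    *)
(* submodule {x | e' g x = 0 for all g} would contradict irreducibility.      *)

(** The center is rewritten through second derivatives of [f] ([form_center_dirder]). Since [d] is
    at least 3, nondegeneracy says that a vector [x] with all [D_u D_v D_x f] zero is zero, which
    makes the center a commutative algebra ([dirder_center_commute], [dirder_center_comp]).
    Invariance of the Jacobian makes the center stable under conjugation ([dirder_center_conj]).
    What remains concerns a conjugation-stable subalgebra of ['End(V)]: its radical maps [V] into a
    proper subspace ([jacobson_radical_proper]), and irreducibility leaves a single orbit of
    primitive idempotents ([primitive_idempotent_transitive]). *)

Local Notation dirders f s := (foldr (@dirder _ _) f s).

(** * Calculus of directional derivatives *)

Lemma dirderM (F : fieldType) (V : vectType F) (v : V)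
    (p q : {mpoly F[\dim {:V}]}) :
  dirder v (p * q) = dirder v p * q + p * dirder v q.
Proof.
rewrite /dirder mulr_suml mulr_sumr -big_split; apply: eq_bigr => i _ /=.
by rewrite mderivM scalerDr scalerAl scalerAr.
Qed.

Lemma dirderXU (F : fieldType) (V : vectType F) (v : V) (i : 'I_(\dim {:V})) :
  dirder v 'X_i = (coords v i)%:MP.
Proof.
rewrite /dirder (bigD1 i) //= big1 => [|j ji]; rewrite mderivX mnm1E.
  rewrite eqxx scale1r addr0 -alg_mpolyC -mpolyX0; congr (_ *: 'X_[_]).
  by apply/mnmP => k; rewrite mnmBE subnn mnm0E.
by rewrite eq_sym (negbTE ji) scale0r scaler0.
Qed.

Lemma dirderC (F : fieldType) (V : vectType F) (v : V) (c : F) :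
  dirder v c%:MP = 0.
Proof. by rewrite /dirder big1 // => i _; rewrite mderivC scaler0. Qed.

Lemma dirder_basis (F : fieldType) (V : vectType F) (i : 'I_(\dim {:V}))
    (f : {mpoly F[\dim {:V}]}) : dirder (vbasis {:V})`_i f = f^`M(i).
Proof.
rewrite /dirder (bigD1 i) //= big1 => [|j ji].
  by rewrite /coords coord_free ?(basis_free (vbasisP _)) // eqxx scale1r addr0.
rewrite /coords coord_free ?(basis_free (vbasisP _)) // eq_sym (negbTE ji).
by rewrite scale0r.
Qed.

Lemma dirderBl (F : fieldType) (V : vectType F) (u v : V)
    (f : {mpoly F[\dim {:V}]}) : dirder (u - v) f = dirder u f - dirder v f.
Proof. by rewrite addrC -scaleN1r dirder_linear scaleN1r addrC. Qed.

Lemma dirder0l (F : fieldType) (V : vectType F) (f : {mpoly F[\dim {:V}]}) :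
  dirder (0 : V) f = 0.
Proof. by rewrite -(subrr (0 : V)) dirderBl subrr. Qed.

Lemma mpoly_ring_ind (n : nat) (R : comNzRingType) (P : {mpoly R[n]} -> Prop) :
  (forall c, P c%:MP) -> (forall i, P 'X_i) ->
  (forall p q, P p -> P q -> P (p + q)) ->
  (forall p q, P p -> P q -> P (p * q)) -> forall p, P p.
Proof.
move=> PC PX PD PM; elim/mpolyind => [|c m p _ _ Pp].
  by rewrite -mpolyC0; apply: PC.
apply: PD Pp; rewrite -mul_mpolyC; apply: (PM) => //.
rewrite mpolyXE_id; elim/big_ind: _ => // [|i _]; first by rewrite -mpolyC1.
by elim: (m i) => [|k IH]; rewrite ?expr0 -?mpolyC1 // exprS; apply: PM.
Qed.

(** The chain rule for a linear substitution: both sides obey the same product rule, so constants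
    and variables suffice. *)
Lemma dirder_form_comp (F : fieldType) (V : vectType F) (u : V)
    (h : {mpoly F[\dim {:V}]}) (X : 'End(V)) :
  dirder u (form_comp h X) = form_comp (dirder (X u) h) X.
Proof.
rewrite /form_comp; elim/mpoly_ring_ind: h => [c|i|p q Hp Hq|p q Hp Hq].
- by rewrite comp_mpolyC !dirderC comp_mpoly0.
- rewrite dirderXU comp_mpolyC comp_mpolyXU -tnth_nth tnth_mktuple.
  rewrite linear_sum /= {2}(coord_vbasis (memvf u)) /coords !linear_sum /=.
  rewrite raddf_sum /=; apply: eq_bigr => j _.
  by rewrite linearZ /= dirderXU !linearZ /= -mul_mpolyC -mpolyCM mulrC.
- by rewrite comp_mpolyD !linearD /= Hp Hq.
by rewrite rmorphM !dirderM rmorphD !rmorphM /= Hp Hq.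
Qed.

(** A monomial of positive degree contains some variable; differentiating in it multiplies the
    coefficient by a positive integer, nonzero in characteristic 0. *)
Lemma eq0_dirder (F : numFieldType) (V : vectType F) (d : nat)
    (h : {mpoly F[\dim {:V}]}) :
  h \is d.+1.-homog -> (forall v, dirder v h = 0) -> h = 0.
Proof.
move=> hh h0; apply/mpolyP => m; rewrite mcoeff0.
have [m0|[i mi]] : m = 0%MM \/ exists i, m i != 0%N.
  case: (pickP (fun i => m i != 0%N)) => [i mi|m0]; first by right; exists i.
  by left; apply/mnmP => i; rewrite mnm0E; apply/eqP/negbFE/m0.
  by apply: (dhomog_nemf_coeff hh); rewrite m0 /= mdeg0.
have := congr1 (mcoeff (m - U_(i))%MM) (h0 (vbasis {:V})`_i).
rewrite dirder_basis mcoeff0 mcoeff_mderiv submK; last first.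
  by rewrite lep1mP.
by move/eqP; rewrite mulrn_eq0 => /orP[//|/eqP].
Qed.

Lemma eq0_dirders (F : numFieldType) (V : vectType F) (d : nat)
    (h : {mpoly F[\dim {:V}]}) :
  h \is d.-homog ->
  (forall s : seq V, size s = d -> (dirders h s)@_0%MM = 0) -> h = 0.
Proof.
elim: d h => [|d IH] h hh h0.
  apply/mpolyP => m; rewrite mcoeff0.
  have [->|m0] := eqVneq m 0%MM; first exact: (h0 [::]).
  by apply: (dhomog_nemf_coeff hh); rewrite mdeg_eq0.
apply: (eq0_dirder hh) => v; apply: IH; first exact: dirder_homog.
move=> s sd; rewrite -foldr_rcons; apply: h0.
by rewrite size_rcons sd.
Qed.

(** * The center through second derivatives *)

(** [polarization] is a chosen value; uniqueness identifies it with the iterated derivative. *)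
Lemma polarizationE (F : numFieldType) (V : vectType F) (d : nat)
    (f : {mpoly F[\dim {:V}]}) (w : {ffun 'I_d -> V}) : f \is d.-homog ->
  polarization f w
  = d`!%:R^-1 * (dirders f [seq w i | i <- enum 'I_d])@_0%MM.
Proof.
move=> hf; pose Theta (w : {ffun 'I_d -> V}) :=
  d`!%:R^-1 * (dirders f [seq w i | i <- enum 'I_d])@_0%MM.
suff H : is_polarization f Theta.
  by rewrite (polarization_uniq (polarizationP hf) H).
split=> [{}w i a x y|{}w s|v]; rewrite /Theta.
- have E z : dirders f [seq set_arg w i z k | k <- enum 'I_d] =
      dirder z (dirders f [seq w k | k <- rem i (enum 'I_d)]).
    rewrite (dirders_perm _ (perm_map _ (perm_to_rem (mem_enum 'I_d i)))) /=.
    rewrite ffunE eqxx; congr (dirder _ (foldr _ _ _)); apply/eq_in_map => k.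
    by rewrite mem_rem_uniq ?enum_uniq // inE ffunE => /andP[/negbTE ->].
  by rewrite !E dirder_linear mcoeffD mcoeffZ mulrDr mulrCA.
- congr (_ * _@_ _); apply: dirders_perm.
  rewrite (eq_map (g := w \o s)); last by move=> k; rewrite ffunE.
  rewrite map_comp; apply: perm_map; apply: uniq_perm; rewrite ?enum_uniq //.
    by rewrite map_inj_uniq ?enum_uniq //; apply: perm_inj.
  by move=> k; rewrite -(permKV s k) (mem_map perm_inj) !mem_enum.
rewrite (eq_map (g := fun=> v)) => [|k]; last by rewrite ffunE.
have -> (s : seq 'I_d) : dirders f [seq v | _ <- s] = iter (size s) (dirder v) f.
  by elim: s => //= _ s ->.
rewrite size_enum_ord iter_dirder // mulKf //.
by rewrite pnatr_eq0 -lt0n fact_gt0.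
Qed.

Definition dirder_center (F : fieldType) (V : vectType F)
    (f : {mpoly F[\dim {:V}]}) : set 'End(V) :=
  [set X | forall u v, dirder (X u) (dirder v f) = dirder u (dirder (X v) f)].

(** [X] acts only on the first two slots. The other [d] slots are arbitrary, and derivatives along
    them detect whether the degree [d] form [D_{Xu} D_v f - D_u D_{Xv} f] vanishes. *)
Lemma form_center_dirder (F : numFieldType) (V : vectType F) (d : nat)
    (f : {mpoly F[\dim {:V}]}) : f \is d.+2.-homog ->
  form_center d.+2 f = dirder_center f.
Proof.
move=> hf.
have E (w : {ffun 'I_d.+2 -> V}) : [seq w i | i <- enum 'I_d.+2] =
    w ord0 :: w (lift ord0 ord0)
    :: [seq w (lift ord0 (lift ord0 k)) | k <- enum 'I_d].
  by rewrite !enum_ordSl /= -!map_comp.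
(* [foldr] differentiates along the head of the list last; [P] moves the two slots touched by [X]
   next to [f]. *)
have P (x y : V) s :
    dirder x (dirder y (dirders f s)) = dirders (dirder x (dirder y f)) s.
  rewrite -[LHS]/(dirders f (x :: y :: s)) (@dirders_perm _ _ _ (s ++ [:: x; y]))
    ?foldr_cat //.
  by rewrite -[_ :: _]/([:: x; y] ++ s) perm_catC.
have d0 : (d.+2)`!%:R^-1 != 0 :> F.
  by rewrite invr_eq0 pnatr_eq0 -lt0n fact_gt0.
apply/seteqP; split=> X /= hX.
  move=> u v; apply/eqP; rewrite -subr_eq0; apply/eqP.
  apply: (@eq0_dirders _ _ d) => [|s sd].
    by rewrite rpredB // !dirder_homog.
  pose w := [ffun k : 'I_d.+2 => nth 0 (u :: v :: s) k].
  have := hX w; rewrite !polarizationE // !E !ffunE /= => /(mulfI d0).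
  set s1 := map _ _; set s2 := map _ _.
  have -> : s2 = s1 by apply/eq_map => k; rewrite !ffunE.
  have -> : s1 = s.
    rewrite -[RHS](mkseq_nth 0) sd /mkseq -val_enum_ord -map_comp.
    by apply/eq_map => k; rewrite !ffunE.
  rewrite !P => e; have -> : forall p q : {mpoly F[\dim {:V}]},
      dirders (p - q) s = dirders p s - dirders q s.
    by elim: s {sd w s1 s2 e} => //= x s IH p q; rewrite IH linearB.
  by rewrite mcoeffB e subrr.
move=> w; rewrite !polarizationE // !E !ffunE /= !P hX.
by congr (_ * (dirders _ _)@_ _); apply/eq_map => k; rewrite !ffunE.
Qed.

Lemma nondegenerate_dirder (F : numFieldType) (V : vectType F) (d : nat)
    (f : {mpoly F[\dim {:V}]}) (x : V) :
  f \is d.+3.-homog -> nondegenerate_form f ->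
  (forall u v, dirder u (dirder v (dirder x f)) = 0) -> x = 0.
Proof.
move=> hf nd h; apply: nd; apply: (@eq0_dirder _ _ d.+1).
  exact: dirder_homog.
move=> v; apply: (@eq0_dirder _ _ d) => [|u]; last exact: h.
by rewrite !dirder_homog.
Qed.

Lemma dirder_center_id (F : fieldType) (V : vectType F)
    (f : {mpoly F[\dim {:V}]}) : dirder_center f \1%VF.
Proof. by move=> u v; rewrite !id_lfunE. Qed.

Lemma dirder_center_linear (F : fieldType) (V : vectType F)
    (f : {mpoly F[\dim {:V}]}) (a : F) (X Y : 'End(V)) :
  dirder_center f X -> dirder_center f Y -> dirder_center f (a *: X + Y).
Proof.
move=> hX hY u v; rewrite !lfunE /= !lfunE /= !dirder_linear hX hY.
by rewrite linearP.
Qed.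

(** In the symmetric expression [D_u D_v D_w f], sliding [X] to [w] and [Y] to [v] turns both [XYu]
    and [YXu] into [D_{Xw} D_{Yv} D_u f]. *)
Lemma dirder_center_commute (F : numFieldType) (V : vectType F) (d : nat)
    (f : {mpoly F[\dim {:V}]}) (X Y : 'End(V)) :
  f \is d.+3.-homog -> nondegenerate_form f ->
  dirder_center f X -> dirder_center f Y -> (X \o Y)%VF = (Y \o X)%VF.
Proof.
move=> hf nd hX hY; apply/lfunP => u; rewrite !comp_lfunE.
apply/eqP; rewrite -subr_eq0; apply/eqP; apply: (nondegenerate_dirder hf nd).
move=> v w; rewrite dirderBl !linearB /=; apply/eqP; rewrite subr_eq0.
apply/eqP; rewrite -(hX w) (dirder_comm v) -(hY v u).
by rewrite (dirder_comm v w) -(hY v) (dirder_comm w) -(hX w) dirder_comm.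
Qed.

(** Sliding [X] and then [Y] across reverses their order, which commutativity repairs. *)
Lemma dirder_center_comp (F : numFieldType) (V : vectType F) (d : nat)
    (f : {mpoly F[\dim {:V}]}) (X Y : 'End(V)) :
  f \is d.+3.-homog -> nondegenerate_form f ->
  dirder_center f X -> dirder_center f Y -> dirder_center f (X \o Y)%VF.
Proof.
move=> hf nd hX hY u v; rewrite {2}(dirder_center_commute hf nd hX hY).
by rewrite !comp_lfunE hX hY.
Qed.

(* The symmetry of D_x D_y D_v' f in x and y lets X jump from x to y.         *)
Lemma dirder_centerP (F : numFieldType) (V : vectType F) (d : nat)
    (f : {mpoly F[\dim {:V}]}) (X : 'End(V)) : f \is d.+3.-homog ->
  (forall v, exists v', forall x,
     dirder (X x) (dirder v f) = dirder x (dirder v' f)) ->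
  dirder_center f X.
Proof.
move=> hf h u v; apply/eqP; rewrite -subr_eq0; apply/eqP.
apply: (@eq0_dirder _ _ d) => [|z]; first by rewrite rpredB // !dirder_homog.
have [z' hz] := h z; rewrite linearB /=; apply/eqP; rewrite subr_eq0; apply/eqP.
rewrite (dirder_comm z) (dirder_comm z v) (dirder_comm (X u)) hz.
by rewrite (dirder_comm z) (dirder_comm z (X v)) hz dirder_comm.
Qed.

(** * Spans and the Jacobian *)

Definition linear_set (F : fieldType) (W : lmodType F) (S : set W) : Prop :=
  S 0 /\ forall a x y, S x -> S y -> S (a *: x + y).

Lemma span_of_linear (F : fieldType) (W : lmodType F) (S : set W) :
  linear_set (span_of S).
Proof.
split=> [|a x y [m [b [s [hs ->]]]] [n [c [t [ht ->]]]]].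
  by exists 0%N, (fun=> 0), (fun=> 0); split; [case | rewrite big_ord0].
exists (m + n)%N, (fun i => match split i with inl j => a * b j | inr k => c k end),
  (fun i => match split i with inl j => s j | inr k => t k end); split.
  by move=> i; case: (split i).
rewrite big_split_ord scaler_sumr; congr (_ + _); apply: eq_bigr => i _.
  by rewrite (unsplitK (inl i)) scalerA.
by rewrite (unsplitK (inr i)).
Qed.

Lemma span_of_sub (F : fieldType) (W : lmodType F) (S T : set W) :
  linear_set T -> S `<=` T -> span_of S `<=` T.
Proof.
move=> [T0 TD] ST _ [m [c [s [hs ->]]]].
by elim/big_rec: _ => // i x _ Tx; apply: TD => //; apply: ST.
Qed.

Lemma sub_span_of (F : fieldType) (W : lmodType F) (S : set W) :
  S `<=` span_of S.
Proof.
move=> x Sx; exists 1%N, (fun=> 1), (fun=> x); split=> //.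
by rewrite big_ord1 scale1r.
Qed.

(** [dirder v f] is linear in [v], so the derivatives already form a subspace. *)
Lemma jacobianP (F : fieldType) (V : vectType F) (f h : {mpoly F[\dim {:V}]}) :
  jacobian f h <-> exists v, h = dirder v f.
Proof.
split; last by move=> hv; apply: sub_span_of.
move: h; apply: (@span_of_sub _ _ _ [set h | exists v, h = dirder v f]) => //.
split=> [|a _ _ [x ->] [y ->]].
  by exists 0; rewrite dirder0l.
by exists (a *: x + y); rewrite dirder_linear.
Qed.

(** * Conjugation on the center and its radical *)

Lemma linear_actionK (G : groupType) (F : fieldType) (V : vectType F)
    (rho : G -> 'End(V)) (g : G) (v : V) :
  linear_action rho -> rho g (rho g^-1%g v) = v.
Proof. by case=> h1 hM; rewrite -comp_lfunE -hM mulgV h1 id_lfunE. Qed.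

Lemma linear_actionVK (G : groupType) (F : fieldType) (V : vectType F)
    (rho : G -> 'End(V)) (g : G) (v : V) :
  linear_action rho -> rho g^-1%g (rho g v) = v.
Proof. by case=> h1 hM; rewrite -comp_lfunE -hM mulVg h1 id_lfunE. Qed.

Lemma conj_actE (G : groupType) (F : fieldType) (V : vectType F)
    (rho : G -> 'End(V)) (g : G) (z : 'End(V)) (v : V) :
  conj_act rho g z v = rho g (z (rho g^-1%g v)).
Proof. by rewrite !comp_lfunE. Qed.

Lemma conj_actVK (G : groupType) (F : fieldType) (V : vectType F)
    (rho : G -> 'End(V)) (g : G) (z : 'End(V)) :
  linear_action rho -> conj_act rho g (conj_act rho g^-1%g z) = z.
Proof.
by move=> h; apply/lfunP => v; rewrite !conj_actE invgK !linear_actionK.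
Qed.

Lemma conj_actK (G : groupType) (F : fieldType) (V : vectType F)
    (rho : G -> 'End(V)) (g : G) (z : 'End(V)) :
  linear_action rho -> conj_act rho g^-1%g (conj_act rho g z) = z.
Proof. by move=> h; rewrite -{2}(invgK g) conj_actVK. Qed.

Lemma conj_act_comp (G : groupType) (F : fieldType) (V : vectType F)
    (rho : G -> 'End(V)) (g : G) (y z : 'End(V)) : linear_action rho ->
  conj_act rho g (y \o z)%VF = (conj_act rho g y \o conj_act rho g z)%VF.
Proof.
move=> h; apply/lfunP => v; rewrite comp_lfunE !conj_actE comp_lfunE.
by rewrite linear_actionVK.
Qed.

Lemma conj_actD (G : groupType) (F : fieldType) (V : vectType F)
    (rho : G -> 'End(V)) (g : G) (y z : 'End(V)) :
  conj_act rho g (y + z) = conj_act rho g y + conj_act rho g z.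
Proof. by rewrite /conj_act comp_lfunDr comp_lfunDl. Qed.

Lemma conj_actN (G : groupType) (F : fieldType) (V : vectType F)
    (rho : G -> 'End(V)) (g : G) (z : 'End(V)) :
  conj_act rho g (- z) = - conj_act rho g z.
Proof. by rewrite /conj_act comp_lfunNr comp_lfunNl. Qed.

Lemma conj_act0 (G : groupType) (F : fieldType) (V : vectType F)
    (rho : G -> 'End(V)) (g : G) : conj_act rho g 0 = 0.
Proof. by rewrite /conj_act comp_lfun0r comp_lfun0l. Qed.

Lemma conj_act_eq0 (G : groupType) (F : fieldType) (V : vectType F)
    (rho : G -> 'End(V)) (g : G) (z : 'End(V)) :
  linear_action rho -> conj_act rho g z = 0 -> z = 0.
Proof. by move=> h e; rewrite -(conj_actK g z h) e conj_act0. Qed.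

(** Invariance of the Jacobian gives [D_v f = g (D_w f)] and [g (D_{Xw} f) = D_{w'} f]. By the chain
    rule, the criterion of [dirder_centerP] for [gXg^-1] at [v] becomes centrality of [X] at
    [g^-1 x] and [w]. *)
Lemma dirder_center_conj (G : groupType) (F : numFieldType) (V : vectType F)
    (rho : G -> 'End(V)) (d : nat) (f : {mpoly F[\dim {:V}]}) (g : G)
    (X : 'End(V)) :
  linear_action rho -> f \is d.+3.-homog -> invariant_jacobian rho f ->
  dirder_center f X -> dirder_center f (conj_act rho g X).
Proof.
move=> hrho hf hJ hX; apply: (dirder_centerP hf) => v.
have : (form_act rho g @` jacobian f) (dirder v f).
  by rewrite hJ; apply/jacobianP; exists v.
move=> [_ /jacobianP[w ->] hw].
have : jacobian f (form_act rho g (dirder (X w) f)).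
  by rewrite -(hJ g); exists (dirder (X w) f) => //; apply/jacobianP; exists (X w).
move=> /jacobianP[w' hw']; exists w' => x.
rewrite -hw -hw' /form_act !dirder_form_comp conj_actE linear_actionVK //.
by rewrite hX.
Qed.

(* The maximal left ideals are permuted by conjugation. *)
Lemma jacobson_radical_conj (G : groupType) (F : fieldType) (V : vectType F)
    (rho : G -> 'End(V)) (A : set 'End(V)) (g : G) (x : 'End(V)) :
  linear_action rho -> (forall g x, A x -> A (conj_act rho g x)) ->
  jacobson_radical A x -> jacobson_radical A (conj_act rho g x).
Proof.
move=> hrho hA [Ax xM]; split=> [|M [lM MA maxM]]; first exact: hA.
pose P g (I : set 'End(V)) := [set y | I (conj_act rho g y)].
have PA k : P k A = A.
  apply/seteqP; split=> y /=; last exact: hA.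
  by move=> /(hA k^-1%g); rewrite conj_actK.
have Pl k I : left_ideal A I -> left_ideal A (P k I).
  move=> [IA I0 IB IM]; split=> [y /IA| |y z|a y Aa] /=.
  - by rewrite -{2}(PA k).
  - by rewrite /P /= conj_act0.
  - by rewrite /P /= conj_actD conj_actN; apply: IB.
  by rewrite /P /= conj_act_comp //; apply: IM; apply: hA.
have PK k I : P k (P k^-1%g I) = I.
  by apply/seteqP; split=> y /=; rewrite /P /= conj_actK.
apply: (xM (P g M)); split=> [|e|I lI MI]; first exact: Pl.
  by apply: MA; rewrite -(PK g^-1%g M) invgK e PA.
case: (maxM (P g^-1%g I)) => [|y My|e|e]; first exact: Pl.
- by apply: MI; rewrite /P /= conj_actVK.
- by left; rewrite -e PK.
by right; rewrite -(PK g I) e PA.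
Qed.

(** * The radical maps [V] into a proper subspace *)

Lemma exists_max_dimv (F : fieldType) (W : vectType F) (P : {vspace W} -> Prop) :
  (exists U, P U) ->
  exists2 U, P U & forall U', P U' -> (\dim U' <= \dim U)%N.
Proof.
move=> [U0 PU0].
have H0 : exists k, `[< exists2 U, P U & \dim U = k >].
  by exists (\dim U0); apply/asboolP; exists U0.
have Hle k : `[< exists2 U, P U & \dim U = k >] -> (k <= \dim {:W})%N.
  by move=> /asboolP[U _ <-]; rewrite dimvS ?subvf.
case: (ex_maxnP H0 Hle) => k /asboolP[U PU <-] max.
by exists U => // U' PU'; apply: max; apply/asboolP; exists U'.
Qed.

(** A subspace [U] of maximal dimension inside [S] absorbs each [x] of [S], because [U + <[x]>]
    still lies in [S]. *)
Lemma linear_setP (F : fieldType) (W : vectType F) (S : set W) :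
  linear_set S -> exists U : {vspace W}, forall x, S x <-> x \in U.
Proof.
move=> [S0 SD].
have [|U US max] := @exists_max_dimv _ W (fun U => forall x, x \in U -> S x).
  by exists 0%VS => x; rewrite memv0 => /eqP ->.
exists U => x; split=> [Sx|]; last exact: US.
have /max dU : forall y, y \in (U + <[x]>)%VS -> S y.
  move=> _ /memv_addP[u uU [_ /vlineP[a ->] ->]].
  by rewrite addrC; apply: SD => //; apply: US.
suff -> : U = (U + <[x]>)%VS by rewrite (subvP (addvSr _ _)) ?memv_line.
by apply/eqP; rewrite eqEdim addvSl.
Qed.

(* For a maximal proper A-stable U and v outside U, the quotient V / U is     *)
(* simple, so {a | a v \in U} is a maximal left ideal and contains rad A.     *)
Lemma jacobson_radical_proper (F : fieldType) (V : vectType F)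
    (A : set 'End(V)) :
  (0 < \dim {:V})%N -> linear_set A -> A \1%VF ->
  (forall x y, A x -> A y -> A (x \o y)%VF) ->
  exists2 U : {vspace V}, U <> fullv &
    forall n v, jacobson_radical A n -> n v \in U.
Proof.
move=> dV [A0 AD] A1 AM.
have AB x y : A x -> A y -> A (x - y).
  by move=> Ax Ay; rewrite addrC -scaleN1r; apply: AD.
pose stable (U : {vspace V}) :=
  U <> fullv /\ forall a v, A a -> v \in U -> a v \in U.
have [|U [Uf Us] max] := @exists_max_dimv _ V stable.
  exists 0%VS; split=> [e|a v _]; first by rewrite -e dimv0 in dV.
  by rewrite memv0 => /eqP ->; rewrite linear0 mem0v.
exists U => // n v [An nM]; have [vU|vU] := boolP (v \in U); first exact: Us.
pose M := [set a | A a /\ a v \in U].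
suff maxM : maximal_left_ideal A M by case: (nM _ maxM).
have lM : left_ideal A M.
  split=> [a []|| x y [Ax xv] [Ay yv]|a x Aa [Ax xv]] //.
  - by split=> //; rewrite zero_lfunE mem0v.
  - by split; [apply: AB | rewrite add_lfunE opp_lfunE rpredB].
  by split; [apply: AM | rewrite comp_lfunE; apply: Us].
split=> // [e|I [IA I0 IB IM] MI].
  have : M \1%VF by rewrite e.
  by case=> _; rewrite id_lfunE (negbTE vU).
have [IM'|/existsNP[a /not_implyP[Ia naM]]] := pselect (I `<=` M).
  by left; apply/seteqP; split.
right; have Aa := IA _ Ia.
have avU : a v \notin U by apply/negP => av; apply: naM.
(* [S] is [U + A(av)], an [A]-stable subspace strictly larger than [U], hence all of [V] by
   maximality. *)
pose S := [set z | exists u b, [/\ u \in U, A b & z = u + b (a v)]].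
have [|U' SU'] := @linear_setP _ V S.
  split=> [|c _ _ [u1 [b1 [Uu1 Ab1 ->]]] [u2 [b2 [Uu2 Ab2 ->]]]].
    by exists 0, 0; rewrite mem0v zero_lfunE addr0.
  exists (c *: u1 + u2), (c *: b1 + b2); split; first by rewrite rpredD ?rpredZ.
    exact: AD.
  by rewrite add_lfunE scale_lfunE scalerDr addrACA.
have UU' : (U <= U')%VS.
  apply/subvP => u uU; apply/SU'; exists u, 0.
  by rewrite zero_lfunE addr0.
have avU' : a v \in U'.
  by apply/SU'; exists 0, \1%VF; rewrite mem0v id_lfunE add0r.
have U'f : U' = fullv.
  apply/not_notP => U'f; have /max dU' : stable U'.
    split=> // b _ Ab /SU'[u [c [uU Ac ->]]]; apply/SU'.
    exists (b u), (b \o c)%VF; split; [exact: Us | exact: AM |].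
    by rewrite linearD comp_lfunE.
  have /eqP e : U == U' by rewrite eqEdim UU'.
  by rewrite e avU' in avU.
(* From [v = u + b(av)], the element [1 - ba] sends [v] into [U], so it lies in [M] and hence in
   [I]; as [ba] is in [I] too, so is 1. *)
have /SU'[u [b [uU Ab vE]]] : v \in U' by rewrite U'f memvf.
have Iba : I (b \o a)%VF by apply: IM.
have I1 : I \1%VF.
  have : I (\1 - (b \o a))%VF.
    apply: MI; split; first by apply: AB => //; apply: AM.
    by rewrite add_lfunE opp_lfunE id_lfunE comp_lfunE {1}vE addrK.
  by move=> /IB/(_ (IB _ _ I0 Iba)); rewrite sub0r opprK subrK.
apply/seteqP; split=> // c Ac.
by rewrite -(comp_lfun1r c); apply: IM.
Qed.

(** This rests on [g(nu) = (gng^-1)(gu)]. *)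
Lemma set_mul_submodule (G : groupType) (F : fieldType) (V : vectType F)
    (rho : G -> 'End(V)) (N : set 'End(V)) :
  linear_action rho -> (forall g n, N n -> N (conj_act rho g n)) ->
  submodule rho (set_mul N).
Proof.
move=> hrho hN; have [S0 SD] := @span_of_linear _ _
  [set v | exists2 n, N n & exists u, v = n u].
split=> // g; apply: span_of_sub.
  split=> [|a x y hx hy]; first by rewrite /= linear0.
  by rewrite /= linearP; apply: SD.
move=> _ [n Nn [u ->]] /=; apply: sub_span_of.
exists (conj_act rho g n); first exact: hN.
by exists (rho g u); rewrite conj_actE linear_actionVK.
Qed.

(** * Primitive idempotents and their orbit *)

(** By commutativity, [e = pe + (e - pe)] splits [e] into orthogonal idempotents of [A], and
    primitivity kills one of them. *)
Lemma primitive_idempotent_dichotomy (F : fieldType) (V : vectType F)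
    (A : set 'End(V)) (e p : 'End(V)) :
  linear_set A -> (forall x y, A x -> A y -> A (x \o y)%VF) ->
  (forall x y, A x -> A y -> (x \o y)%VF = (y \o x)%VF) ->
  primitive_idempotent A e -> idempotent_in A p ->
  (p \o e)%VF = 0 \/ (p \o e)%VF = e.
Proof.
move=> [_ AD] AM AC [[Ae ee] _ prim] [Ap pp].
have pe := AC _ _ Ap Ae.
have ppe : (p \o (p \o e) = p \o e)%VF by rewrite comp_lfunA pp.
have epe : (e \o (p \o e) = p \o e)%VF by rewrite pe comp_lfunA ee.
have pee : ((p \o e) \o e = p \o e)%VF by rewrite -comp_lfunA ee.
have pepe : ((p \o e) \o (p \o e) = p \o e)%VF by rewrite -comp_lfunA epe ppe.
have Ape : A (p \o e)%VF by apply: AM.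
have Aq : A (e - (p \o e))%VF by rewrite addrC -scaleN1r; apply: AD.
have pq : ((p \o e) \o (e - (p \o e)) = 0)%VF.
  by rewrite comp_lfunDr comp_lfunNr pee pepe subrr.
have qp : ((e - (p \o e)) \o (p \o e) = 0)%VF by rewrite -(AC _ _ Ape Aq).
case: (prim (p \o e)%VF (e - (p \o e))%VF) => //.
- split=> //; rewrite comp_lfunDr comp_lfunNr qp subr0.
  by rewrite comp_lfunDl comp_lfunNl ee pee.
- by rewrite addrC subrK.
- by left.
by move/eqP; rewrite subr_eq0 => /eqP <-; right.
Qed.

Lemma primitive_idempotent_eq (F : fieldType) (V : vectType F)
    (A : set 'End(V)) (e e' : 'End(V)) :
  linear_set A -> (forall x y, A x -> A y -> A (x \o y)%VF) ->
  (forall x y, A x -> A y -> (x \o y)%VF = (y \o x)%VF) ->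
  primitive_idempotent A e -> primitive_idempotent A e' ->
  (e' \o e)%VF <> 0 -> e' = e.
Proof.
move=> Al AM AC pe pe' ne; have [ie _ _] := pe; have [ie' _ _] := pe'.
have E := AC _ _ ie.1 ie'.1.
case: (primitive_idempotent_dichotomy Al AM AC pe ie') => // <-.
by case: (primitive_idempotent_dichotomy Al AM AC pe' ie); rewrite E.
Qed.

(* A nonzero idempotent of minimal rank is primitive. *)
Lemma primitive_idempotent_exists (F : fieldType) (V : vectType F)
    (A : set 'End(V)) :
  (0 < \dim {:V})%N -> A \1%VF -> primitive_idempotent A !=set0.
Proof.
move=> dV A1.
pose P k := `[< exists e, [/\ idempotent_in A e, e <> 0 & \dim (limg e) = k] >].
have P0 : exists k, P k.
  exists (\dim (limg (\1%VF : 'End(V)))); apply/asboolP; exists \1%VF; split=> //.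
    by split=> //; rewrite comp_lfun1l.
  move=> e; suff E : {:V}%VS = 0%VS by rewrite E dimv0 in dV.
  by apply/vspaceP => v; rewrite memvf memv0 -[v]id_lfunE e zero_lfunE eqxx.
case: (ex_minnP P0) => k /asboolP[e [ie ne <-]] min; exists e; split=> //.
move=> e1 e2 ie1 ie2 e12 e21 E.
have [->|ne1] := pselect (e1 = 0); first by left.
right; apply/lfunP => u.
have ee1 : (e \o e1 = e1)%VF by rewrite E comp_lfunDl ie1.2 e21 addr0.
have ee2 : (e \o e2 = e2)%VF by rewrite E comp_lfunDl ie2.2 e12 add0r.
(* Minimal rank forces [e1] and [e] to have the same image, so [e2 u = e1 w] for some [w]; applying
   [e2] gives 0. *)
have /eqP L : limg e1 == limg e.
  rewrite eqEdim -{1}ee1 limg_comp limgS ?subvf //=.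
  by apply: min; apply/asboolP; exists e1.
have : e2 u \in limg e1 by rewrite L -ee2 comp_lfunE memv_img ?memvf.
move=> /memv_imgP[w _ h].
by rewrite -{1}ie2.2 comp_lfunE h -comp_lfunE e21 !zero_lfunE.
Qed.

Lemma primitive_idempotent_conj (G : groupType) (F : fieldType) (V : vectType F)
    (rho : G -> 'End(V)) (A : set 'End(V)) (g : G) (e : 'End(V)) :
  linear_action rho -> (forall g x, A x -> A (conj_act rho g x)) ->
  primitive_idempotent A e -> primitive_idempotent A (conj_act rho g e).
Proof.
move=> hrho hA; have idem k x :
    idempotent_in A x -> idempotent_in A (conj_act rho k x).
  by move=> [Ax xx]; split; [apply: hA | rewrite -conj_act_comp // xx].
move=> [ie ne prim]; split=> [||e1 e2 ie1 ie2 e12 e21 E]; first exact: idem.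
  by move=> /(conj_act_eq0 hrho).
have [] := prim (conj_act rho g^-1%g e1) (conj_act rho g^-1%g e2).
- exact: idem.
- exact: idem.
- by rewrite -conj_act_comp // e12 conj_act0.
- by rewrite -conj_act_comp // e21 conj_act0.
- by rewrite -conj_actD -E conj_actK.
- by move/(conj_act_eq0 hrho); left.
by move/(conj_act_eq0 hrho); right.
Qed.

(* If e' kills every translate g e V, then the submodule of all x with        *)
(* e' g x = 0 for every g contains e V, hence is V, and e' = 0.               *)
Lemma primitive_idempotent_transitive (G : groupType) (F : fieldType)
    (V : vectType F) (rho : G -> 'End(V)) (A : set 'End(V)) :
  (0 < \dim {:V})%N -> linear_action rho -> irreducible rho ->
  linear_set A -> A \1%VF -> (forall x y, A x -> A y -> A (x \o y)%VF) ->
  (forall x y, A x -> A y -> (x \o y)%VF = (y \o x)%VF) ->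
  (forall g x, A x -> A (conj_act rho g x)) ->
  acts_transitively (conj_act rho) (primitive_idempotent A).
Proof.
move=> dV hrho [_ irr] Al A1 AM AC hA; split=> [|g e|e e' pe pe'].
- exact: primitive_idempotent_exists.
- exact: primitive_idempotent_conj.
apply/not_notP => /forallNP ng.
have e'g g : (e' \o conj_act rho g e)%VF = 0.
  apply/not_notP => h; apply: (ng g).
  by apply: (primitive_idempotent_eq Al AM AC) => //;
    apply: primitive_idempotent_conj.
pose K := [set x | forall g, e' (rho g x) = 0].
have sK : submodule rho K.
  split=> [g|a x y Kx Ky g|g x Kx h]; first by rewrite !linear0.
    by rewrite !linearP /= Kx Ky scaler0 addr0.
  by rewrite -[rho h _]comp_lfunE -hrho.2.
have [_ ne _] := pe; have [_ ne' _] := pe'.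
have Ke u : K (e u).
  move=> g; have := congr1 (fun z : 'End(V) => z (rho g u)) (e'g g).
  by rewrite comp_lfunE conj_actE linear_actionVK // zero_lfunE.
case: (irr K sK) => E.
  apply: ne; apply/lfunP => u; rewrite zero_lfunE.
  by have := Ke u; rewrite E.
apply: ne'; apply/lfunP => u; rewrite zero_lfunE.
have /(_ 1%g) : K u by rewrite E.
by rewrite hrho.1 id_lfunE.
Qed.

(** * Blocks and conclusion *)

(** [g^-1] is onto, so [geg^-1] and [ge] have the same image; this carries transitivity from
    idempotents to blocks. *)
Lemma limg_conj_act (G : groupType) (F : fieldType) (V : vectType F)
    (rho : G -> 'End(V)) (g : G) (e : 'End(V)) : linear_action rho ->
  limg (conj_act rho g e) = space_act rho g (limg e).
Proof.
move=> hrho; rewrite /space_act -limg_comp.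
apply/vspaceP => v; apply/memv_imgP/memv_imgP => -[u _ ->].
  by exists (rho g^-1%g u); rewrite ?memvf // -[RHS]comp_lfunE.
by exists (rho g u); rewrite ?memvf // conj_actE linear_actionVK ?comp_lfunE.
Qed.

Theorem lemma2p6 (R : realType) (G : groupType) (V : vectType R[i])
    (rho : G -> 'End(V)) (d : nat) (f : {mpoly R[i][\dim {:V}]}) :
  linear_action rho ->
  (0 < \dim {:V})%N ->
  (3 <= d)%N ->
  f \is d.-homog ->
  nondegenerate_form f ->
  invariant_jacobian rho f ->
  let Z := form_center d f in
  let N := jacobson_radical Z in
  (submodule rho (set_mul N) /\ set_mul N <> setT) /\
  (irreducible rho ->
     [/\ N = [set 0],
         acts_transitively (conj_act rho) (primitive_idempotent Z)
       & acts_transitively (space_act rho) (canonical_blocks Z)]).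
Proof.
move=> hrho dV; case: d => [|[|[|d]]] // _ hf nd hJ.
rewrite (form_center_dirder hf) => Z N.
have Z1 : Z \1%VF := dirder_center_id f.
have Zl : linear_set Z.
  split; last by move=> a x y; apply: dirder_center_linear.
  by move=> u v; rewrite !zero_lfunE !dirder0l linear0.
have ZM x y : Z x -> Z y -> Z (x \o y)%VF by apply: dirder_center_comp hf nd.
have ZC x y : Z x -> Z y -> (x \o y)%VF = (y \o x)%VF.
  exact: dirder_center_commute hf nd.
have ZJ g x : Z x -> Z (conj_act rho g x) by apply: dirder_center_conj hf hJ.
have sN : submodule rho (set_mul N).
  have NJ g n : N n -> N (conj_act rho g n) by apply: jacobson_radical_conj.
  exact: set_mul_submodule hrho NJ.
have NVT : set_mul N <> setT.
  have [U Uf NU] := jacobson_radical_proper dV Zl Z1 ZM.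
  move=> NT; apply: Uf; apply/vspaceP => v; rewrite memvf.
  have : set_mul N v by rewrite NT.
  apply: (span_of_sub (T := [set v | v \in U])) => [|_ [n Nn [u ->]]].
    split=> [|a x y Ux Uy]; first exact: mem0v.
    by rewrite /= rpredD ?rpredZ.
  exact: NU.
split=> [|irr]; first exact: conj sN NVT.
have tr := primitive_idempotent_transitive dV hrho irr Zl Z1 ZM ZC ZJ.
have N0 : N = [set 0].
  (* Irreducibility leaves 0 or [V], and [NVT] excludes [V]; each [n] in [N] then kills every
     vector. *)
  have NV0 : set_mul N = [set 0] by case: (irr.2 _ sN).
  apply/seteqP; split=> [n Nn|_ ->]; last first.
    by split=> [|M [[]]]; first exact: Zl.1.
  apply/lfunP => u; rewrite zero_lfunE.
  have : set_mul N (n u) by apply: sub_span_of; exists n => //; exists u.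
  by rewrite NV0.
split; [exact: N0 | exact: tr |].
have [[e pe] st trans] := tr; split=> [|g _ [x px ->]|_ _ [x px ->] [y py ->]].
- by exists (limg e), e.
- by exists (conj_act rho g x); [exact: st | rewrite limg_conj_act].
by have [g ->] := trans x y px py; exists g; rewrite limg_conj_act.
Qed.
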